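(* Let $K$ be a field of characteristic $p\ge 0$, and let $f_1,f_2\in K[x]$ be nonconstant polynomials. If $f_1$ and $f_2$ have a common composite, then they have a common composite of degree $\mathrm{lcm}(\deg(f_1),\deg(f_2))\,p^s$ for some integer $s\ge 0$. (Here the convention $0^0=1$ is used.)
   Context: Nonconstant polynomials $f_1,f_2\in K[x]$ have a common composite (over $K$) if there are nonconstant $u,v\in K[x]$ such that $u(f_1(x))=v(f_2(x))$; any such (nonconstant) polynomial $u(f_1(x))$ is called a common composite of $f_1$ and $f_2$. *)

(* Defs.v *)
From HB Require Import structures.
From mathcomp Require Import all_boot all_order all_algebra.

Set Implicit Arguments.
Unset Strict Implicit.
Unset Printing Implicit Defensive.

Import GRing.Theory.
Local Open Scope ring_scope.

(* [pchar R] only contains primes, so that characteristic 0 is encoded by its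
   being empty. *)
Definition has_characteristic (R : nzRingType) (p : nat) : Prop :=
  p \in [pchar R] \/ (p = 0%N /\ [pchar R] =i pred0).

(* The zero polynomial gets degree 0. *)
Definition degree (R : nzRingType) (f : {poly R}) : nat := (size f).-1.

Definition nonconstant (R : nzRingType) (f : {poly R}) : bool := (1 < size f)%N.

Definition is_common_composite (K : fieldType) (f1 f2 h : {poly K}) : Prop :=
  exists u v : {poly K},
    [/\ nonconstant u, nonconstant v, h = u \Po f1 & h = v \Po f2].

Definition have_common_composite (K : fieldType) (f1 f2 : {poly K}) : Prop :=
  exists h : {poly K}, is_common_composite f1 f2 h.

(* Main.v *)
Require Import Defs.
From HB Require Import structures.
From mathcomp Require Import all_boot all_order all_algebra.

Set Implicit Arguments.
Unset Strict Implicit.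
Unset Printing Implicit Defensive.

Import GRing.Theory.
Local Open Scope ring_scope.

(** Any common composite [h = u(f1) = v(f2)] can be shrunk by taking a root.

    Scale [h] to be monic, and let [e] be the largest divisor of
    [gcd (deg u, deg v)] that is nonzero in [K].  Since [e] is invertible in
    [K] and divides [deg h], the polynomial [h] has an [e]-th root with leading
    coefficient 1 in the field [K((1/x))] of Laurent series at infinity; let
    [w] be the polynomial part of this root.  As [e] divides [deg u], the root
    already exists in [K((1/f1))], where it is the sum of a polynomial [a(f1)]
    and of a series in negative powers of [f1].  The latter only involves
    negative powers of [x], so [a(f1) = w].  In the same way [b(f2) = w], with
    [b] the polynomial part of an [e]-th root of [v].  So [w] is a common
    composite of degree [deg h / e].  Finally
    [deg h = lcm (deg f1, deg f2) * gcd (deg u, deg v)], and dividing the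
    second factor by [e] leaves a power of the characteristic (which is 1 in
    characteristic 0).

    Series are avoided by the remark that the polynomial part [a] of an [e]-th
    root of [u] is characterised by [deg (u - a^e) < (e - 1) deg a].  Given the
    degree and the leading coefficient of [a], this condition has at most one
    solution ([approx_root_unique]); it has one if [a ^ e] and [u] then agree in
    degree and leading coefficient ([approx_root_exists]); and it is stable
    under composition on the right ([approx_root_comp]), which replaces the
    inclusion of [K((1/f))] in [K((1/x))]. *)

(** If [r ^ e = u] for a Laurent series [r] at infinity with polynomial part
    [a], then [u - a ^ e] is [r - a], of negative degree, times a sum of
    products of [e - 1] factors of degree [deg a]: this is where the bound
    comes from.  The inequality on sizes means
    [deg (u - a ^ e) < (e - 1) deg a], with the zero polynomial of degree
    minus infinity. *)
Definition approx_root (R : nzRingType) (e : nat) (u a : {poly R}) : Prop :=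
  (size (u - a ^+ e)%R <= (size a).-1 * e.-1)%N.

Section IntegralDomain.
Variable R : idomainType.
Implicit Types a b f u : {poly R}.

(** All terms of the cofactor of [a - b] in [a ^+ e - b ^+ e] have the same
    degree and the same leading coefficient, so they do not cancel when [e] is
    nonzero in [R]. *)
Lemma size_coef_cofactor_exp (e m : nat) (c : R) a b : c != 0 ->
    size a = m.+1 -> size b = m.+1 -> lead_coef a = c -> lead_coef b = c ->
  let S := \sum_(i < e) a ^+ (e.-1 - i) * b ^+ i in
  (size S <= (m * e.-1).+1)%N /\ S`_(m * e.-1) = c ^+ e.-1 *+ e.
Proof.
move=> c0 sa sb la lb S.
have term (i : 'I_e) : size (a ^+ (e.-1 - i) * b ^+ i) = (m * e.-1).+1
    /\ lead_coef (a ^+ (e.-1 - i) * b ^+ i) = c ^+ e.-1.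
  have le_i : (i <= e.-1)%N by rewrite -ltnS (leq_trans (ltn_ord i)) ?leqSpred.
  have nza : a ^+ (e.-1 - i) != 0 by rewrite expf_neq0 // -size_poly_eq0 sa.
  have nzb : b ^+ i != 0 by rewrite expf_neq0 // -size_poly_eq0 sb.
  split; last by rewrite lead_coefM !lead_coef_exp la lb -exprD subnK.
  rewrite size_mul // (polySpred nza) (polySpred nzb) !size_exp sa sb /=.
  by rewrite addnS -mulnDr subnK.
split.
  apply: leq_trans (size_sum _ _ _) _; apply/bigmax_leqP => i _.
  by have [-> _] := term i.
rewrite coef_sum (eq_bigr (fun=> c ^+ e.-1)) ?sumr_const ?card_ord // => i _.
by have [si <-] := term i; rewrite lead_coefE si.
Qed.

(** [a ^ e - b ^ e] has degree less than [(e - 1) deg a], which is the degree of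
    its cofactor over [a - b]; so [a - b] has to vanish. *)
Lemma approx_root_unique (e : nat) u a b : e%:R != 0 :> R -> a != 0 ->
    size a = size b -> lead_coef a = lead_coef b ->
  approx_root e u a -> approx_root e u b -> a = b.
Proof.
move=> e0 a0 sab lab ra rb.
have la0 : lead_coef a != 0 by rewrite lead_coef_eq0.
have sa := polySpred a0; have sb : size b = (size a).-1.+1 by rewrite -sab.
have [_ coefS] := size_coef_cofactor_exp e la0 sa sb erefl (esym lab).
set S := \sum_(_ < e) _ in coefS.
have nzS : S`_((size a).-1 * e.-1) != 0.
  by rewrite coefS -mulr_natr mulf_neq0 // expf_neq0.
have big_S : ((size a).-1 * e.-1 < size S)%N.
  by rewrite ltnNge; apply: contra nzS => /(nth_default 0) ->.
have small : (size (a ^+ e - b ^+ e)%R <= (size a).-1 * e.-1)%N.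
  rewrite (_ : _ - _ = (u - b ^+ e) - (u - a ^+ e)); last first.
    by rewrite opprB [RHS]addrC addrA subrK.
  by rewrite (leq_trans (size_polyD _ _)) // size_polyN geq_max {1}sab rb.
apply/eqP; rewrite -subr_eq0; apply/negPn/negP => nzab.
have S0 : S != 0 by rewrite -size_poly_gt0 (leq_trans _ big_S).
move: small; rewrite subrXX size_mul // (polySpred nzab) addSn /=.
by rewrite leqNgt (leq_trans big_S) ?leq_addl.
Qed.

(** Composition with [f] multiplies degrees by [deg f], which preserves strict
    inequalities because [f] is nonconstant. *)
Lemma approx_root_comp (e : nat) u a f : (1 < size f)%N ->
  approx_root e u a -> approx_root e (u \Po f) (a \Po f).
Proof.
rewrite /approx_root => sf ra.
rewrite -rmorphXn -rmorphB size_comp_poly /=.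
have [->|nz] := eqVneq (u - a ^+ e) 0; first by rewrite comp_poly0 size_poly0.
have nzf : (u - a ^+ e) \Po f != 0 by rewrite comp_poly_eq0.
rewrite (polySpred nzf) size_comp_poly mulnAC ltn_mul2r.
by rewrite -subn1 subn_gt0 sf -(polySpred nz).
Qed.

End IntegralDomain.

(** The coefficients of [a] are found one after the other from the top:
    adding [d * 'X^i] to [a], for [i < m], changes the coefficient of [a ^ e] in
    degree [m (e - 1) + i] by [d * e * c ^ (e - 1)], and none in higher
    degree. *)
Lemma approx_root_exists (K : fieldType) (e m : nat) (c : K) (u : {poly K}) :
    e%:R != 0 :> K -> c != 0 ->
    size u = (m * e).+1 -> lead_coef u = c ^+ e ->
  exists a : {poly K},
    [/\ size a = m.+1, lead_coef a = c & approx_root e u a].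
Proof.
move=> e0 c0 su lu.
have e_gt0 : (0 < e)%N by case: e e0 {su lu} => //; rewrite eqxx.
(* [j] counts the coefficients of [a] settled below the leading one. *)
suff /(_ m (leqnn m)) [a [sa la ra]] : forall j, (j <= m)%N ->
    exists a : {poly K}, [/\ size a = m.+1, lead_coef a = c &
      (size (u - a ^+ e)%R <= m * e.-1 + (m - j))%N].
  exists a; split=> //.
  by move: ra; rewrite /approx_root sa subnn addn0.
elim=> [_|j IH lt_jm].
  pose a := c *: 'X^m.
  have sa : size a = m.+1 by rewrite size_scale // size_polyXn.
  have la : lead_coef a = c by rewrite lead_coefZ lead_coefXn mulr1.
  exists a; split=> //; rewrite subn0 -mulnSr prednK //.
  apply/leq_sizeP => i; rewrite leq_eqVlt => /predU1P [<-|lt_i].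
    have Xe : a ^+ e = c ^+ e *: 'X^(m * e) by rewrite exprZn -exprM.
    rewrite coefB Xe coefZ coefXn eqxx mulr1.
    by move: lu; rewrite lead_coefE su /= => ->; rewrite subrr.
  rewrite coefB exprZn -exprM coefZ coefXn gtn_eqF // mulr0 subr0.
  by rewrite nth_default // su.
have [a [sa la ra]] := IH (ltnW lt_jm).
pose i := (m - j.+1)%N.
have lt_im : (i < m)%N by rewrite /i ltn_subrL (leq_ltn_trans _ lt_jm).
have Emj : (m - j = i.+1)%N by rewrite /i subnSK.
pose d := (u - a ^+ e)`_(m * e.-1 + i) / (c ^+ e.-1 *+ e).
pose t := d *: 'X^i; pose b := t + a.
have st : (size t < size a)%N.
  by rewrite (leq_ltn_trans (size_scale_leq _ _)) // size_polyXn sa.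
have sb : size b = m.+1 by rewrite /b addrC size_polyDl.
have lb : lead_coef b = c by rewrite /b lead_coefDr.
exists b; split=> //.
have [sS cS] := size_coef_cofactor_exp e c0 sb sa lb la.
have Eb : b ^+ e - a ^+ e
    = (\sum_(k < e) b ^+ (e.-1 - k) * a ^+ k) * t.
  by rewrite subrXX /b addrK mulrC.
set S := \sum_(_ < e) _ in sS cS Eb.
have -> : u - b ^+ e = (u - a ^+ e) - d *: (S * 'X^i).
  by rewrite scalerAr -Eb opprB addrA subrK.
rewrite -/i; apply/leq_sizeP => k; rewrite leq_eqVlt => /predU1P [<-|lt_k].
  rewrite coefB coefZ coefMXn ltnNge leq_addl /= addnK cS divfK ?subrr //.
  by rewrite -mulr_natr mulf_neq0 // expf_neq0.
rewrite coefB coefZ nth_default; last by rewrite (leq_trans ra) // Emj addnS.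
rewrite coefMXn ltnNge (leq_trans (leq_addl _ _) (ltnW lt_k)) /=.
rewrite nth_default ?mulr0 ?subrr // (leq_trans sS) //.
by rewrite ltn_subRL addnC.
Qed.

(** That [h] is monic makes the leading coefficient of [u] the [e]-th power of
    [lead_coef f ^- degree a], and starting [a] with the latter makes [a(f)]
    monic.  By [approx_root_unique], [a(f)] then depends on [h] and [e] only,
    not on [f]. *)
Lemma approx_root_decomp (K : fieldType) (e : nat) (f u h : {poly K}) :
    e%:R != 0 :> K -> nonconstant f -> nonconstant u -> h = u \Po f ->
    h \is monic -> (e %| degree u)%N ->
  exists a : {poly K},
    [/\ nonconstant a, degree a = (degree u %/ e)%N, a \Po f \is monic
      & approx_root e h (a \Po f)].
Proof.
rewrite /nonconstant /degree => e0 sf su -> /monicP lh ed.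
pose m := ((size u).-1 %/ e)%N.
have Em : (m * e = (size u).-1)%N by rewrite divnK.
have m_gt0 : (0 < m)%N.
  by move: su; rewrite -subn_gt0 subn1 -Em muln_gt0 => /andP [].
have lf0 : lead_coef f != 0.
  by rewrite lead_coef_eq0 -size_poly_gt0 (ltn_trans _ sf).
have nzc : lead_coef f ^- m != 0 by rewrite invr_neq0 // expf_neq0.
have su' : size u = (m * e).+1 by rewrite Em prednK // ltnW.
have lu : lead_coef u = (lead_coef f ^- m) ^+ e.
  apply: (mulIf (expf_neq0 (size u).-1 lf0)); rewrite -lead_coef_comp // lh.
  by rewrite exprVn -exprM Em mulVf ?expf_neq0.
have [a [sa la ra]] := approx_root_exists e0 nzc su' lu.
exists a; split; rewrite ?sa //; last exact: approx_root_comp.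
by apply/monicP; rewrite lead_coef_comp // la sa mulVf ?expf_neq0.
Qed.

Lemma characteristic_exponent_part (R : fieldType) (p n : nat) :
    has_characteristic R p -> (0 < n)%N ->
  exists e s : nat, n = (e * p ^ s)%N /\ e%:R != 0 :> R.
Proof.
case=> [char_p|[-> char0]] n_gt0.
  exists (n`_p^')%N, (logn p n).
  rewrite -p_part mulnC partnC // natf_neq0_pchar.
  by rewrite (eq_pnat _ (eq_negn (pcharf_eq char_p))) part_pnat.
exists n, 0%N; rewrite muln1; split=> //.
by apply/negP => /(natf0_pchar n_gt0) [q]; rewrite char0.
Qed.

Lemma lcmn_mul_gcdn (k l m n : nat) : (k * m = l * n)%N -> (0 < m)%N ->
  (k * m = lcmn m n * gcdn k l)%N.
Proof.
move=> kmln m_gt0.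
have g_gt0 : (0 < gcdn m n)%N by rewrite gcdn_gt0 m_gt0.
have E : (n * gcdn k l = k * gcdn m n)%N.
  by rewrite muln_gcdr ![(n * _)%N]mulnC -kmln -muln_gcdr gcdnC.
apply/eqP; rewrite -(eqn_pmul2r g_gt0) [eqbRHS]mulnAC muln_lcm_gcd.
by rewrite -[eqbRHS]mulnA E [eqbRHS]mulnCA mulnA.
Qed.

Theorem theorem4p1 (K : fieldType) (p : nat) (hp : has_characteristic K p)
    (f1 f2 : {poly K}) (hf1 : nonconstant f1) (hf2 : nonconstant f2) :
  have_common_composite f1 f2 ->
  exists (h : {poly K}) (s : nat),
    is_common_composite f1 f2 h /\
    degree h = (lcmn (degree f1) (degree f2) * p ^ s)%N.
Proof.
case=> h0 [u0 [v0 [nu0 nv0 hu0 hv0]]].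
have deg_gt0 (f : {poly K}) : nonconstant f -> (0 < degree f)%N.
  by rewrite /nonconstant /degree -subn1 subn_gt0.
have nzl : lead_coef h0 != 0.
  have := deg_gt0 _ nu0; have := deg_gt0 _ hf1; rewrite lead_coef_eq0 => d1 d2.
  have: (0 < (size h0).-1)%N by rewrite hu0 size_comp_poly muln_gt0 d2 d1.
  by apply: contraL => /eqP ->; rewrite size_poly0.
pose g := (lead_coef h0)^-1; have nzg : g != 0 by rewrite invr_eq0.
pose u := g *: u0; pose v := g *: v0; pose h := g *: h0.
have nu : nonconstant u by rewrite /nonconstant size_scale.
have nv : nonconstant v by rewrite /nonconstant size_scale.
have hu : h = u \Po f1 by rewrite comp_polyZ -hu0.
have hv : h = v \Po f2 by rewrite comp_polyZ -hv0.
have mh : h \is monic by apply/monicP; rewrite lead_coefZ mulVf.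
have gcd_gt0 : (0 < gcdn (degree u) (degree v))%N by rewrite gcdn_gt0 deg_gt0.
have [e [s [Eg e0]]] := characteristic_exponent_part hp gcd_gt0.
have e_dvd : (e %| gcdn (degree u) (degree v))%N by rewrite Eg dvdn_mulr.
have eu := dvdn_trans e_dvd (dvdn_gcdl _ _).
have ev := dvdn_trans e_dvd (dvdn_gcdr _ _).
have [a [na da ma ra]] := approx_root_decomp e0 hf1 nu hu mh eu.
have [b [nb db mb rb]] := approx_root_decomp e0 hf2 nv hv mh ev.
have e_gt0 : (0 < e)%N by exact: dvdn_gt0 gcd_gt0 e_dvd.
have Edeg : (degree u * degree f1 = degree v * degree f2)%N.
  by rewrite /degree -!size_comp_poly -hu -hv.
have dab : (degree a * degree f1 = degree b * degree f2)%N.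
  by rewrite da db !divn_mulAC ?Edeg.
have Eab : a \Po f1 = b \Po f2.
  apply: (approx_root_unique e0 (monic_neq0 ma) _ _ ra rb).
    rewrite (polySpred (monic_neq0 ma)) (polySpred (monic_neq0 mb)).
    by rewrite !size_comp_poly [X in X.+1]dab.
  by rewrite (monicP ma) (monicP mb).
exists (a \Po f1), s; split; first by exists a, b.
rewrite {1}/degree size_comp_poly -/(degree a) -/(degree f1) da.
rewrite divn_mulAC // (lcmn_mul_gcdn Edeg) ?deg_gt0 // Eg.
by rewrite mulnCA mulKn.
Qed.
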